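(* Each equation $(\Delta_{\alpha},\nabla_{\!\beta})^{*}$ corresponds to the frame condition $(\Delta_{\alpha},\nabla_{\!\beta})^{*}$, i.e. a modal frame (containing the relevant modalities) satisfies the frame condition $(\Delta_{\alpha},\nabla_{\!\beta})^{*}$ if and only if its complex algebra satisfies the equation $(\Delta_{\alpha},\nabla_{\!\beta})^{*}$.
   Context: A frame is a poset $(W,\le)$ with relations $R^{\Box}_+,R^{\Box}_-,R^{\Diamond}_+,R^{\Diamond}_-$ (those for modalities in the signature $\mathcal{L}$), where a $\Box_\alpha$-relation is an upset of $(W,\ge)\times(W,\le)^\alpha$ and a $\Diamond_\alpha$-relation an upset of $(W,\le)\times(W,\le)^{-\alpha}$ ($(W,\le)^+=(W,\le)$, $(W,\le)^-=(W,\ge)$); in this setting the frame is assumed unimodal, i.e. each $R^\Delta_\alpha$ is generated by a single relation $R=\bigcap R^\Delta_\alpha$ via $R^\Box_+={\le}\circ R\circ{\le}$, $R^\Diamond_+={\ge}\circ R\circ{\ge}$, $R^\Box_-={\le}\circ R\circ{\ge}$, $R^\Diamond_-={\ge}\circ R\circ{\le}$. The complex algebra is the lattice of upsets (a bi-Heyting algebra) with $\Box_+a=\{u: uR^\Box_+v\Rightarrow v\in a\}$, $\Box_-a=\{u: uR^\Box_-v\Rightarrow v\notin a\}$, $\Diamond_+a=\{u:\exists v\in a,\ uR^\Diamond_+v\}$, $\Diamond_-a=\{u:\exists v\notin a,\ uR^\Diamond_-v\}$. $\rightarrow$ is Heyting implication and $-$ co-implication. Equations and frame conditions (backward modalities written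 $\overleftarrow{\Box}_\alpha,\overleftarrow{\Diamond}_\alpha$; they serve only as labels): $(\Diamond_+,\Box_+)^*$: $\Box_+a\wedge\Diamond_+b\le\Diamond_+(a\wedge b)$ / $R^\Diamond_+\subseteq(R^\Diamond_+\cap R^\Box_+)\circ{\ge}$; $(\Diamond_-,\Box_-)^*$: $\Box_-a\wedge\Diamond_-b\le\Diamond_-(a\vee b)$ / $R^\Diamond_-\subseteq(R^\Diamond_-\cap R^\Box_-)\circ{\le}$; $(\Box_+,\Diamond_+)^*$: $\Box_+(a\vee b)\le\Box_+a\vee\Diamond_+b$ / $R^\Box_+\subseteq(R^\Box_+\cap R^\Diamond_+)\circ{\le}$; $(\Box_-,\Diamond_-)^*$: $\Box_-(a\wedge b)\le\Box_-a\vee\Diamond_-b$ / $R^\Box_-\subseteq(R^\Box_-\cap R^\Diamond_-)\circ{\ge}$; $(\Diamond_+,\Box_-)^*$: $\Box_-a\wedge\Diamond_+a\le\bot$ / $R^\Diamond_+\subseteq R^\Box_-$; $(\Diamond_-,\Box_+)^*$: $\Box_+a\wedge\Diamond_-a\le\bot$ / $R^\Diamond_-\subseteq R^\Box_+$; $(\Box_+,\Diamond_-)^*$: $\top\le\Box_+a\vee\Diamond_-a$ / $R^\Box_+\subseteq R^\Diamond_-$; $(\Box_-,\Diamond_+)^*$: $\top\le\Box_-a\vee\Diamond_+a$ / $R^\Box_-\subseteq R^\Diamond_+$; $(\overleftarrow{\Diamond}_+,\overleftarrow{\Box}_+)^*$: $\Diamond_+a\rightarrow\Box_+b\le\Box_+(a\rightarrow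 b)$ / $R^\Box_+\subseteq{\le}\circ(R^\Box_+\cap R^\Diamond_+)$; $(\overleftarrow{\Diamond}_-,\overleftarrow{\Box}_-)^*$: $\Diamond_-(a\rightarrow b)\le\Diamond_-b-\Box_-a$ / $R^\Diamond_-\subseteq{\ge}\circ(R^\Diamond_-\cap R^\Box_-)$; $(\overleftarrow{\Box}_+,\overleftarrow{\Diamond}_+)^*$: $\Diamond_+(b-a)\le\Diamond_+b-\Box_+a$ / $R^\Diamond_+\subseteq{\ge}\circ(R^\Diamond_+\cap R^\Box_+)$; $(\overleftarrow{\Box}_-,\overleftarrow{\Diamond}_-)^*$: $\Diamond_-a\rightarrow\Box_-b\le\Box_-(b-a)$ / $R^\Box_-\subseteq{\le}\circ(R^\Box_-\cap R^\Diamond_-)$; $(\overleftarrow{\Diamond}_+,\overleftarrow{\Box}_-)^*$: $\Box_-a\le\Box_+(a\rightarrow\bot)$ / $R^\Box_+\subseteq R^\Box_-$; $(\overleftarrow{\Diamond}_-,\overleftarrow{\Box}_+)^*$: $\Diamond_-(a\rightarrow\bot)\le\Diamond_+a$ / $R^\Diamond_-\subseteq R^\Diamond_+$; $(\overleftarrow{\Box}_+,\overleftarrow{\Diamond}_-)^*$: $\Diamond_+(\top-a)\le\Diamond_-a$ / $R^\Diamond_+\subseteq R^\Diamond_-$; $(\overleftarrow{\Box}_-,\overleftarrow{\Diamond}_+)^*$: $\Box_+a\le\Box_-(\top-a)$ / $R^\Box_-\subseteq R^\Box_+$. *)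

(* Defs.v *)
From HB Require Import structures.
From mathcomp Require Import all_boot all_order.
From mathcomp Require Import boolp classical_sets.

Set Implicit Arguments.
Unset Strict Implicit.
Unset Printing Implicit Defensive.

Import Order.TTheory.

Local Open Scope classical_set_scope.

Inductive sign := Pos | Neg.

Inductive modality := Box of sign | Dia of sign.

Definition signature := pred modality.

(* Composition in diagrammatic order (first R, then S): it is the reading under
   which [<= o R o >=] generates a relation that is downward closed in both
   arguments, as required of R^Box_-.  The library's [B \; A] composes the other
   way round. *)
Definition rcomp (T U V : Type) (R : set (T * U)) (S : set (U * V)) :
    set (T * V) :=
  [set p | exists2 w, R (p.1, w) & S (w, p.2)].

Notation "R ;; S" := (rcomp R S) (at level 40, left associativity).

Definition leR {d : Order.disp_t} {W : porderType d} : set (W * W) :=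
  [set p | (p.1 <= p.2)%O].

Definition geR {d : Order.disp_t} {W : porderType d} : set (W * W) :=
  [set p | (p.2 <= p.1)%O].

Definition is_upset {d : Order.disp_t} (T : porderType d) (A : set T) : Prop :=
  forall x y : T, (x <= y)%O -> A x -> A y.

(* [W^d] is the dual order and [*p] the componentwise order on pairs. *)
Definition modal_relation {d : Order.disp_t} (W : porderType d) (m : modality) :
    set (W * W) -> Prop :=
  match m with
  | Box Pos => @is_upset _ (W^d *p W)%type
  | Box Neg => @is_upset _ (W^d *p W^d)%type
  | Dia Pos => @is_upset _ (W *p W^d)%type
  | Dia Neg => @is_upset _ (W *p W)%type
  end.

Record frame (L : signature) (d : Order.disp_t) (W : porderType d) := Frame {
  frame_rel : forall m, L m -> set (W * W);
  frame_rel_upset : forall m (Lm : L m), modal_relation m (frame_rel Lm)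
}.

Definition generated {d : Order.disp_t} {W : porderType d} (R : set (W * W))
    (m : modality) : set (W * W) :=
  match m with
  | Box Pos => leR ;; R ;; leR
  | Dia Pos => geR ;; R ;; geR
  | Box Neg => leR ;; R ;; geR
  | Dia Neg => geR ;; R ;; leR
  end.

Definition frame_rel_meet (L : signature) (d : Order.disp_t) (W : porderType d)
    (F : frame L W) : set (W * W) :=
  [set p | forall m (Lm : L m), frame_rel F Lm p].

Definition unimodal (L : signature) (d : Order.disp_t) (W : porderType d)
    (F : frame L W) : Prop :=
  forall m (Lm : L m), frame_rel F Lm = generated (frame_rel_meet F) m.

(* [hcoimp b a] is the co-implication b - a. *)
HB.mixin Record isBiHeyting (d : Order.disp_t) T of Order.TBLattice d T := {
  himp : T -> T -> T;
  hcoimp : T -> T -> T;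
  himpP : forall a b c : T, (c <= himp a b)%O = (c `&` a <= b)%O;
  hcoimpP : forall a b c : T, (hcoimp b a <= c)%O = (b <= a `|` c)%O
}.

#[short(type="biHeytingType")]
HB.structure Definition BiHeyting (d : Order.disp_t) :=
  { T of isBiHeyting d T & Order.TBLattice d T }.

Notation "a ~> b" := (himp a b) (at level 55, right associativity).
Notation "b ~- a" := (hcoimp b a) (at level 50, left associativity).

Record modalAlgebra (L : signature) := ModalAlgebra {
  malg_disp : Order.disp_t;
  malg_sort :> biHeytingType malg_disp;
  mop : forall m, L m -> malg_sort -> malg_sort
}.

Definition upsetb {d : Order.disp_t} (W : porderType d) : pred (set W) :=
  fun A => `[< is_upset A >].

Record upset {d : Order.disp_t} (W : porderType d) := Upset {
  upset_val :> set W;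
  _ : upsetb upset_val
}.

Fact upset_display (d : Order.disp_t) : Order.disp_t. Proof. by []. Qed.

Section UpsetLattice.
Variables (d : Order.disp_t) (W : porderType d).

HB.instance Definition _ := [isSub of upset W for @upset_val d W].
HB.instance Definition _ := [Choice of upset W by <:].

Lemma upsetP (A : upset W) : is_upset (val A).
Proof. exact/asboolP/(valP A). Qed.

Definition mk_upset (A : set W) (upA : is_upset A) : upset W :=
  Upset (asboolT upA : upsetb A).

Fact upset_meet_closed : Order.ClosedPredicates.meet_closed (@upsetb d W).
Proof.
move=> A B /asboolP upA /asboolP upB; apply/asboolP => x y xy [Ax Bx].
by split; [exact: upA xy Ax | exact: upB xy Bx].
Qed.

Fact upset_join_closed : Order.ClosedPredicates.join_closed (@upsetb d W).
Proof.
move=> A B /asboolP upA /asboolP upB; apply/asboolP => x y xy [Ax|Bx].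
- by left; exact: upA xy Ax.
- by right; exact: upB xy Bx.
Qed.

Fact upset_bot : \bot%O \in @upsetb d W.
Proof. by apply/asboolP => x y _. Qed.

Fact upset_top : \top%O \in @upsetb d W.
Proof. exact/asboolP. Qed.

HB.instance Definition _ :=
  Order.SubChoice_isTBSubLattice.Build set_display (set W) (@upsetb d W)
    (upset_display d) (upset W)
    upset_meet_closed upset_join_closed upset_bot upset_top.

Lemma upset_meetE (a b : upset W) : val (a `&` b)%O = val a `&` val b.
Proof. exact: Order.valI_subproof. Qed.

Lemma upset_joinE (a b : upset W) : val (a `|` b)%O = val a `|` val b.
Proof. exact: Order.valU_subproof. Qed.

Definition upset_imp_set (A B : set W) : set W :=
  [set u | forall v, (u <= v)%O -> A v -> B v].

Definition upset_coimp_set (B A : set W) : set W :=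
  [set u | exists2 v, (v <= u)%O & B v /\ ~ A v].

Fact upset_imp_upset (A B : set W) : is_upset (upset_imp_set A B).
Proof. by move=> x y xy Ax v yv; apply: Ax; exact: le_trans xy yv. Qed.

Fact upset_coimp_upset (B A : set W) : is_upset (upset_coimp_set B A).
Proof. by move=> x y xy [v vx BAv]; exists v => //; exact: le_trans vx xy. Qed.

Definition upset_imp (a b : upset W) : upset W :=
  mk_upset (@upset_imp_upset (val a) (val b)).

Definition upset_coimp (b a : upset W) : upset W :=
  mk_upset (@upset_coimp_upset (val b) (val a)).

Lemma le_upsetP (a b : upset W) : reflect (val a `<=` val b) (a <= b)%O.
Proof. by rewrite -Order.le_val; exact: subsetPset. Qed.

Fact upset_impP (a b c : upset W) :
  (c <= upset_imp a b)%O = (c `&` a <= b)%O.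
Proof.
apply/le_upsetP/le_upsetP => [ci x|ci x cx v xv av].
- by rewrite upset_meetE => -[cx ax]; exact: (ci x cx x).
- apply: ci; rewrite upset_meetE; split => //.
  exact: (upsetP xv cx).
Qed.

Fact upset_coimpP (a b c : upset W) :
  (upset_coimp b a <= c)%O = (b <= a `|` c)%O.
Proof.
apply/le_upsetP/le_upsetP => [ci x bx|ci x [v vx [bv nav]]].
- rewrite upset_joinE.
  have [ax|nax] := pselect (val a x); first by left.
  by right; apply: ci; exists x.
- apply: (upsetP vx).
  by move: (ci _ bv); rewrite upset_joinE => -[/nav|].
Qed.

HB.instance Definition _ :=
  isBiHeyting.Build (upset_display d) (upset W) upset_impP upset_coimpP.

End UpsetLattice.

Definition modal_set {d : Order.disp_t} {W : porderType d} (m : modality)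
    (R : set (W * W)) (a : set W) : set W :=
  match m with
  | Box Pos => [set u | forall v, R (u, v) -> a v]
  | Box Neg => [set u | forall v, R (u, v) -> ~ a v]
  | Dia Pos => [set u | exists2 v, a v & R (u, v)]
  | Dia Neg => [set u | exists2 v, ~ a v & R (u, v)]
  end.

Fact modal_set_upset (d : Order.disp_t) (W : porderType d) (m : modality)
    (R : set (W * W)) (a : set W) :
  modal_relation m R -> is_upset (modal_set m R a).
Proof.
case: m => -[] /= upR x y xy.
- by move=> ax v yv; apply: ax; apply: (upR (y, v)) => //; apply/andP; split.
- by move=> ax v yv; apply: ax; apply: (upR (y, v)) => //; apply/andP; split.
- move=> [v av xv]; exists v => //.
  by apply: (upR (x, v)) => //; apply/andP; split.
- move=> [v av xv]; exists v => //.
  by apply: (upR (x, v)) => //; apply/andP; split.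
Qed.

Definition complex_algebra (L : signature) (d : Order.disp_t) (W : porderType d)
    (F : frame L W) : modalAlgebra L :=
  {| malg_sort := upset W;
     mop := fun m Lm a =>
       mk_upset (modal_set_upset (a := val a) (frame_rel_upset F Lm)) |}.

(* [DiaBox x y], [BoxDia x y] are the labels (Dia_x, Box_y)* and
   (Box_x, Dia_y)*; the [Back] versions are the same pairs with backward
   modalities. *)
Inductive label :=
  | DiaBox of sign & sign
  | BoxDia of sign & sign
  | BackDiaBox of sign & sign
  | BackBoxDia of sign & sign.

(* The two modalities of the signature that occur in the equation and in the
   frame condition.  For a backward label with mixed signs they are two boxes or
   two diamonds. *)
Definition label_modalities (l : label) : modality * modality :=
  match l with
  | DiaBox x y => (Dia x, Box y)
  | BoxDia x y => (Box x, Dia y)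
  | BackDiaBox Pos Pos => (Dia Pos, Box Pos)
  | BackDiaBox Neg Neg => (Dia Neg, Box Neg)
  | BackBoxDia Pos Pos => (Box Pos, Dia Pos)
  | BackBoxDia Neg Neg => (Box Neg, Dia Neg)
  | BackDiaBox Pos Neg => (Box Pos, Box Neg)
  | BackDiaBox Neg Pos => (Dia Neg, Dia Pos)
  | BackBoxDia Pos Neg => (Dia Pos, Dia Neg)
  | BackBoxDia Neg Pos => (Box Neg, Box Pos)
  end.

Definition equation (L : signature) (A : modalAlgebra L) (l : label) :
    L (label_modalities l).1 -> L (label_modalities l).2 -> Prop :=
  match l
    return L (label_modalities l).1 -> L (label_modalities l).2 -> Prop
  with
  | DiaBox Pos Pos => fun (dp : L (Dia Pos)) (bp : L (Box Pos)) =>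
      forall a b : A, (mop bp a `&` mop dp b <= mop dp (a `&` b))%O
  | DiaBox Neg Neg => fun (dn : L (Dia Neg)) (bn : L (Box Neg)) =>
      forall a b : A, (mop bn a `&` mop dn b <= mop dn (a `|` b))%O
  | BoxDia Pos Pos => fun (bp : L (Box Pos)) (dp : L (Dia Pos)) =>
      forall a b : A, (mop bp (a `|` b) <= mop bp a `|` mop dp b)%O
  | BoxDia Neg Neg => fun (bn : L (Box Neg)) (dn : L (Dia Neg)) =>
      forall a b : A, (mop bn (a `&` b) <= mop bn a `|` mop dn b)%O
  | DiaBox Pos Neg => fun (dp : L (Dia Pos)) (bn : L (Box Neg)) =>
      forall a : A, (mop bn a `&` mop dp a <= \bot)%O
  | DiaBox Neg Pos => fun (dn : L (Dia Neg)) (bp : L (Box Pos)) =>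
      forall a : A, (mop bp a `&` mop dn a <= \bot)%O
  | BoxDia Pos Neg => fun (bp : L (Box Pos)) (dn : L (Dia Neg)) =>
      forall a : A, (\top <= mop bp a `|` mop dn a)%O
  | BoxDia Neg Pos => fun (bn : L (Box Neg)) (dp : L (Dia Pos)) =>
      forall a : A, (\top <= mop bn a `|` mop dp a)%O
  | BackDiaBox Pos Pos => fun (dp : L (Dia Pos)) (bp : L (Box Pos)) =>
      forall a b : A, (mop dp a ~> mop bp b <= mop bp (a ~> b))%O
  | BackDiaBox Neg Neg => fun (dn : L (Dia Neg)) (bn : L (Box Neg)) =>
      forall a b : A, (mop dn (a ~> b) <= mop dn b ~- mop bn a)%O
  | BackBoxDia Pos Pos => fun (bp : L (Box Pos)) (dp : L (Dia Pos)) =>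
      forall a b : A, (mop dp (b ~- a) <= mop dp b ~- mop bp a)%O
  | BackBoxDia Neg Neg => fun (bn : L (Box Neg)) (dn : L (Dia Neg)) =>
      forall a b : A, (mop dn a ~> mop bn b <= mop bn (b ~- a))%O
  | BackDiaBox Pos Neg => fun (bp : L (Box Pos)) (bn : L (Box Neg)) =>
      forall a : A, (mop bn a <= mop bp (a ~> \bot))%O
  | BackDiaBox Neg Pos => fun (dn : L (Dia Neg)) (dp : L (Dia Pos)) =>
      forall a : A, (mop dn (a ~> \bot) <= mop dp a)%O
  | BackBoxDia Pos Neg => fun (dp : L (Dia Pos)) (dn : L (Dia Neg)) =>
      forall a : A, (mop dp (\top ~- a) <= mop dn a)%O
  | BackBoxDia Neg Pos => fun (bn : L (Box Neg)) (bp : L (Box Pos)) =>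
      forall a : A, (mop bp a <= mop bn (\top ~- a))%O
  end.

Definition frame_condition (L : signature) (d : Order.disp_t)
    (W : porderType d) (F : frame L W) (l : label) :
    L (label_modalities l).1 -> L (label_modalities l).2 -> Prop :=
  let R m (Lm : L m) := frame_rel F Lm in
  match l
    return L (label_modalities l).1 -> L (label_modalities l).2 -> Prop
  with
  | DiaBox Pos Pos => fun (dp : L (Dia Pos)) (bp : L (Box Pos)) =>
      R _ dp `<=` (R _ dp `&` R _ bp) ;; geR
  | DiaBox Neg Neg => fun (dn : L (Dia Neg)) (bn : L (Box Neg)) =>
      R _ dn `<=` (R _ dn `&` R _ bn) ;; leR
  | BoxDia Pos Pos => fun (bp : L (Box Pos)) (dp : L (Dia Pos)) =>
      R _ bp `<=` (R _ bp `&` R _ dp) ;; leR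
  | BoxDia Neg Neg => fun (bn : L (Box Neg)) (dn : L (Dia Neg)) =>
      R _ bn `<=` (R _ bn `&` R _ dn) ;; geR
  | DiaBox Pos Neg => fun (dp : L (Dia Pos)) (bn : L (Box Neg)) =>
      R _ dp `<=` R _ bn
  | DiaBox Neg Pos => fun (dn : L (Dia Neg)) (bp : L (Box Pos)) =>
      R _ dn `<=` R _ bp
  | BoxDia Pos Neg => fun (bp : L (Box Pos)) (dn : L (Dia Neg)) =>
      R _ bp `<=` R _ dn
  | BoxDia Neg Pos => fun (bn : L (Box Neg)) (dp : L (Dia Pos)) =>
      R _ bn `<=` R _ dp
  | BackDiaBox Pos Pos => fun (dp : L (Dia Pos)) (bp : L (Box Pos)) =>
      R _ bp `<=` leR ;; (R _ bp `&` R _ dp)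
  | BackDiaBox Neg Neg => fun (dn : L (Dia Neg)) (bn : L (Box Neg)) =>
      R _ dn `<=` geR ;; (R _ dn `&` R _ bn)
  | BackBoxDia Pos Pos => fun (bp : L (Box Pos)) (dp : L (Dia Pos)) =>
      R _ dp `<=` geR ;; (R _ dp `&` R _ bp)
  | BackBoxDia Neg Neg => fun (bn : L (Box Neg)) (dn : L (Dia Neg)) =>
      R _ bn `<=` leR ;; (R _ bn `&` R _ dn)
  | BackDiaBox Pos Neg => fun (bp : L (Box Pos)) (bn : L (Box Neg)) =>
      R _ bp `<=` R _ bn
  | BackDiaBox Neg Pos => fun (dn : L (Dia Neg)) (dp : L (Dia Pos)) =>
      R _ dn `<=` R _ dp
  | BackBoxDia Pos Neg => fun (dp : L (Dia Pos)) (dn : L (Dia Neg)) =>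
      R _ dp `<=` R _ dn
  | BackBoxDia Neg Pos => fun (bn : L (Box Neg)) (bp : L (Box Pos)) =>
      R _ bn `<=` R _ bp
  end.

(* Main.v *)
(** Each frame condition yields its equation by chasing points through the
    definitions of the modal operators.  Conversely, to find the pair required
    by the frame condition at related points [u] and [v], evaluate the equation
    at [u] on the least upset containing [v], on the largest upset avoiding [v],
    or on an upset cut out by the set of successors of [u]; monotonicity of the
    relations then moves the witnesses obtained in this way back to [v]. *)

Require Import Defs.
From mathcomp Require Import all_boot all_order.
From mathcomp Require Import boolp classical_sets.

Set Implicit Arguments.
Unset Strict Implicit.
Unset Printing Implicit Defensive.

Import Order.TTheory.

Local Open Scope classical_set_scope.

Section Correspondence.
Variables (d : Order.disp_t) (W : porderType d).
Implicit Types (u v w : W) (a b : upset W) (B D : set (W * W)).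

Local Notation box_pos := (modal_set (Box Pos)).
Local Notation box_neg := (modal_set (Box Neg)).
Local Notation dia_pos := (modal_set (Dia Pos)).
Local Notation dia_neg := (modal_set (Dia Neg)).

(** * Bounds of the upset lattice and the two families of test upsets *)

Lemma upset0E : val (\bot%O : upset W) = set0.
Proof. by []. Qed.

Lemma upset1E : val (\top%O : upset W) = setT.
Proof. by []. Qed.

Fact principal_upset v : is_upset [set w | (v <= w)%O].
Proof. by move=> x y xy /= /le_trans; apply. Qed.

Fact avoiding_upset v : is_upset [set w | ~ (w <= v)%O].
Proof. by move=> x y xy /= nxv yv; apply: nxv; exact: le_trans yv. Qed.

Definition principal v : upset W := mk_upset (principal_upset (v := v)).

(** Order dual of [principal v]: classically, a point outside it lies below [v], which is why its
    complement is opened with [contrapT]. *)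
Definition avoiding v : upset W := mk_upset (avoiding_upset (v := v)).

(** * Variance of the four kinds of modal relations, one argument at a time *)

Lemma box_pos_mono B u u' v v' : modal_relation (Box Pos) B ->
  (u' <= u)%O -> (v <= v')%O -> B (u, v) -> B (u', v').
Proof. by move=> upB uu vv; apply: upB; apply/andP. Qed.

Lemma box_neg_mono B u u' v v' : modal_relation (Box Neg) B ->
  (u' <= u)%O -> (v' <= v)%O -> B (u, v) -> B (u', v').
Proof. by move=> upB uu vv; apply: upB; apply/andP. Qed.

Lemma dia_pos_mono D u u' v v' : modal_relation (Dia Pos) D ->
  (u <= u')%O -> (v' <= v)%O -> D (u, v) -> D (u', v').
Proof. by move=> upD uu vv; apply: upD; apply/andP. Qed.

Lemma dia_neg_mono D u u' v v' : modal_relation (Dia Neg) D ->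
  (u <= u')%O -> (v <= v')%O -> D (u, v) -> D (u', v').
Proof. by move=> upD uu vv; apply: upD; apply/andP. Qed.

(** * Forward labels with equal signs *)

Lemma DiaBox_pos_pos D B :
    modal_relation (Dia Pos) D -> modal_relation (Box Pos) B ->
  D `<=` (D `&` B) ;; geR <->
  forall a b, box_pos B (val a) `&` dia_pos D (val b) `<=`
              dia_pos D (val a `&` val b).
Proof.
move=> upD upB; split=> [H a b u [Ba [v bv Duv]]|H [u v] Duv].
  have [w [Duw Buw] vw] := H _ Duv.
  by exists w => //; split; [exact: Ba | exact: upsetP vw bv].
(* The successors of [u] form the least upset whose positive box contains [u], hence the sharpest
   choice of [a]. *)
have upS : is_upset [set w | B (u, w)].
  by move=> x y xy; exact: box_pos_mono upB (lexx u) xy.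
have [|w [Buw vw] Duw] := H (mk_upset upS) (principal v) u; last by exists w.
by split=> [w //|]; exists v => //=.
Qed.

Lemma DiaBox_neg_neg D B :
    modal_relation (Dia Neg) D -> modal_relation (Box Neg) B ->
  D `<=` (D `&` B) ;; leR <->
  forall a b, box_neg B (val a) `&` dia_neg D (val b) `<=`
              dia_neg D (val a `|` val b).
Proof.
move=> upD upB; split=> [H a b u [Ba [v bv Duv]]|H [u v] Duv].
  have [w [Duw Buw] wv] := H _ Duv.
  exists w => // -[aw|bw]; first exact: Ba Buw aw.
  by apply: bv; exact: upsetP wv bw.
(* Dually, this is the largest upset whose negative box contains [u]. *)
have upS : is_upset [set w | ~ B (u, w)].
  by move=> x y xy nB By; apply: nB; exact: box_neg_mono upB (lexx u) xy By.
have [|w /not_orP[/contrapT Buw /contrapT wv] Duw] :=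
  H (mk_upset upS) (avoiding v) u; last by exists w.
by split=> [w Buw /(_ Buw)//|]; exists v => //=; apply.
Qed.

Lemma BoxDia_pos_pos B D :
    modal_relation (Box Pos) B -> modal_relation (Dia Pos) D ->
  B `<=` (B `&` D) ;; leR <->
  forall a b, box_pos B (val a `|` val b) `<=`
              box_pos B (val a) `|` dia_pos D (val b).
Proof.
move=> upB upD; split=> [H a b u Bab|H [u v] Buv].
  have [Db|nDb] := pselect (dia_pos D (val b) u); [by right|left=> v Buv].
  have [w [Buw Duw] wv] := H _ Buv.
  have [aw|bw] := Bab w Buw; first exact: upsetP wv aw.
  by case: nDb; exists w.
have upS : is_upset [set w | ~ D (u, w)].
  by move=> x y xy nD Dy; apply: nD; exact: dia_pos_mono upD (lexx u) xy Dy.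
(* Without a witness, every [B]-successor of [u] below [v] fails to be a [D]-successor, so [u] lies
   in the box of the join. Yet [v] itself keeps [u] out of the box of [avoiding v], and no point
   outside the [D]-successors is a [D]-successor. *)
apply: contrapT => nex.
have [w Buw||[w nDuw Duw]] := H (avoiding v) (mk_upset upS) u; last exact: nDuw.
- apply: contrapT => /not_orP[/contrapT wv /contrapT Duw].
  by apply: nex; exists w.
- by move/(_ v Buv); apply; exact: lexx.
Qed.

Lemma BoxDia_neg_neg B D :
    modal_relation (Box Neg) B -> modal_relation (Dia Neg) D ->
  B `<=` (B `&` D) ;; geR <->
  forall a b, box_neg B (val a `&` val b) `<=`
              box_neg B (val a) `|` dia_neg D (val b).
Proof.
move=> upB upD; split=> [H a b u Bab|H [u v] Buv].
  have [Db|nDb] := pselect (dia_neg D (val b) u); [by right|left=> v Buv av].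
  have [w [Buw Duw] vw] := H _ Buv.
  apply: (Bab w Buw); split; first exact: upsetP vw av.
  by apply: contrapT => bw; apply: nDb; exists w.
(* Least upset whose negative diamond omits [u]. *)
have upS : is_upset [set w | D (u, w)].
  by move=> x y xy; exact: dia_neg_mono upD (lexx u) xy.
apply: contrapT => nex.
have [w Buw [vw Duw]||[w nDuw Duw]] := H (principal v) (mk_upset upS) u.
- by apply: nex; exists w.
- by move/(_ v Buv); apply; exact: lexx.
- exact: nDuw.
Qed.

(** * Forward labels with mixed signs *)

Lemma DiaBox_pos_neg D B : modal_relation (Box Neg) B ->
  D `<=` B <->
  forall a, box_neg B (val a) `&` dia_pos D (val a) `<=` set0.
Proof.
move=> upB; split=> [H a u [Ba [v av /H Buv]]|H [u v] Duv]; first exact: Ba av.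
apply: contrapT => nBuv; apply: (H (principal v) u).
(* A [B]-successor of [u] above [v] would give [B (u, v)], as [B] is downward closed in its second
   argument. *)
split=> [w Buw vw|]; last by exists v => //=.
by apply: nBuv; exact: box_neg_mono upB (lexx u) vw Buw.
Qed.

Lemma DiaBox_neg_pos D B : modal_relation (Box Pos) B ->
  D `<=` B <->
  forall a, box_pos B (val a) `&` dia_neg D (val a) `<=` set0.
Proof.
move=> upB; split=> [H a u [Ba [v av /H Buv]]|H [u v] Duv].
  by apply: av; exact: Ba.
apply: contrapT => nBuv; apply: (H (avoiding v) u).
split=> [w Buw wv|]; last by exists v => //=; apply.
by apply: nBuv; exact: box_pos_mono upB (lexx u) wv Buw.
Qed.

Lemma BoxDia_pos_neg B D : modal_relation (Dia Neg) D ->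
  B `<=` D <->
  forall a, setT `<=` box_pos B (val a) `|` dia_neg D (val a).
Proof.
move=> upD; split=> [H a u _|H [u v] Buv].
  have [Da|nDa] := pselect (dia_neg D (val a) u); [by right|left=> v /H Duv].
  by apply: contrapT => av; apply: nDa; exists v.
(* The box alternative would put [v] in [avoiding v]; the diamond one gives a [D]-successor below
   [v], which can be raised to [v]. *)
have [/(_ v Buv)|[w /contrapT wv]] := H (avoiding v) u I.
  by case; exact: lexx.
exact: dia_neg_mono upD (lexx u) wv.
Qed.

Lemma BoxDia_neg_pos B D : modal_relation (Dia Pos) D ->
  B `<=` D <->
  forall a, setT `<=` box_neg B (val a) `|` dia_pos D (val a).
Proof.
move=> upD; split=> [H a u _|H [u v] Buv].
  have [Da|nDa] := pselect (dia_pos D (val a) u); [by right|left=> v /H Duv av].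
  by apply: nDa; exists v.
have [/(_ v Buv)|[w vw]] := H (principal v) u I.
  by case; exact: lexx.
exact: dia_pos_mono upD (lexx u) vw.
Qed.

(** * Backward labels with equal signs: the first argument moves *)

Lemma BackDiaBox_pos_pos D B :
    modal_relation (Dia Pos) D -> modal_relation (Box Pos) B ->
  B `<=` leR ;; (B `&` D) <->
  forall a b, upset_imp_set (dia_pos D (val a)) (box_pos B (val b)) `<=`
              box_pos B (upset_imp_set (val a) (val b)).
Proof.
move=> upD upB; split=> [H a b u Hu v Buv v' vv' av'|H [u v] Buv].
  (* The frame condition is used at [v'] rather than [v], since it is at [v'] that [b] has to be
     checked. *)
  have [w uw [Bwv Dwv]] := H _ (box_pos_mono upB (lexx u) vv' Buv).
  by apply: (Hu w uw) Bwv; exists v'.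
apply: contrapT => nex.
(* The point [v] refutes the implication from [principal v] to [avoiding v], so it suffices to put
   [u] in the left side of the inclusion; any obstruction at some [w] above [u] would be the missing
   witness. *)
suff /(H (principal v) (avoiding v) u)/(_ v Buv v (lexx v) (lexx v)) :
    upset_imp_set (dia_pos D (principal v)) (box_pos B (avoiding v)) u.
  by apply; exact: lexx.
move=> w uw [v1 vv1 Dwv1] v2 Bwv2 v2v; apply: nex; exists w => //; split.
- exact: box_pos_mono upB (lexx w) v2v Bwv2.
- exact: dia_pos_mono upD (lexx w) vv1 Dwv1.
Qed.

Lemma BackDiaBox_neg_neg D B :
    modal_relation (Dia Neg) D -> modal_relation (Box Neg) B ->
  D `<=` geR ;; (D `&` B) <->
  forall a b, dia_neg D (upset_imp_set (val a) (val b)) `<=`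
              upset_coimp_set (dia_neg D (val b)) (box_neg B (val a)).
Proof.
move=> upD upB; split=> [H a b u [v nv Duv]|H [u v] Duv].
  have [v' vv' [av' nbv']] : exists2 v', (v <= v')%O & val a v' /\ ~ val b v'.
    apply: contrapT => nex; apply: nv => v' vv' av'.
    by apply: contrapT => nbv'; apply: nex; exists v'.
  have [w wu [Dwv Bwv]] := H _ (dia_neg_mono upD (lexx u) vv' Duv).
  by exists w => //; split; [exists v' | move/(_ _ Bwv)].
have [|w wu [[v1 /contrapT v1v Dwv1] nB]] := H (principal v) (avoiding v) u.
  exists v => // /(_ v (lexx v) (lexx v)); apply; exact: lexx.
exists w => //; split; first exact: dia_neg_mono upD (lexx w) v1v Dwv1.
(* If [B (w, v)] failed, no [B]-successor of [w] could lie above [v], so [w] would be in the box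
   that the co-implication excludes. *)
apply: contrapT => nBwv; apply: nB => v2 Bwv2 vv2.
by apply: nBwv; exact: box_neg_mono upB (lexx w) vv2 Bwv2.
Qed.

Lemma BackBoxDia_pos_pos B D :
    modal_relation (Box Pos) B -> modal_relation (Dia Pos) D ->
  D `<=` geR ;; (D `&` B) <->
  forall a b, dia_pos D (upset_coimp_set (val b) (val a)) `<=`
              upset_coimp_set (dia_pos D (val b)) (box_pos B (val a)).
Proof.
move=> upB upD; split=> [H a b u [v [v' v'v [bv' nav']] Duv]|H [u v] Duv].
  have [w wu [Dwv Bwv]] := H _ (dia_pos_mono upD (lexx u) v'v Duv).
  by exists w => //; split; [exists v' | move/(_ _ Bwv)].
have [|w wu [[v1 vv1 Dwv1] nB]] := H (avoiding v) (principal v) u.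
  (* Here [v] serves twice: as the [D]-successor of [u], and as the point of [principal v] outside
     [avoiding v]. *)
  by exists v => //; exists v => //; split=> [|/=]; [exact: lexx | apply].
exists w => //; split; first exact: dia_pos_mono upD (lexx w) vv1 Dwv1.
apply: contrapT => nBwv; apply: nB => v2 Bwv2 v2v.
by apply: nBwv; exact: box_pos_mono upB (lexx w) v2v Bwv2.
Qed.

Lemma BackBoxDia_neg_neg B D :
    modal_relation (Box Neg) B -> modal_relation (Dia Neg) D ->
  B `<=` leR ;; (B `&` D) <->
  forall a b, upset_imp_set (dia_neg D (val a)) (box_neg B (val b)) `<=`
              box_neg B (upset_coimp_set (val b) (val a)).
Proof.
move=> upB upD; split=> [H a b u Hu v Buv [v' v'v [bv' nav']]|H [u v] Buv].
  have [w uw [Bwv Dwv]] := H _ (box_neg_mono upB (lexx u) v'v Buv).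
  by apply: (Hu w uw) Bwv bv'; exists v'.
apply: contrapT => nex.
suff /(H (avoiding v) (principal v) u)/(_ v Buv) :
    upset_imp_set (dia_neg D (avoiding v)) (box_neg B (principal v)) u.
  by apply; exists v => //; split=> [|/=]; [exact: lexx | apply].
move=> w uw [v1 /contrapT v1v Dwv1] v2 Bwv2 vv2.
apply: nex; exists w => //; split.
- exact: box_neg_mono upB (lexx w) vv2 Bwv2.
- exact: dia_neg_mono upD (lexx w) v1v Dwv1.
Qed.

(** * Backward labels with mixed signs: pseudo-complements and their duals *)

Lemma BackDiaBox_pos_neg B B' :
    modal_relation (Box Pos) B -> modal_relation (Box Neg) B' ->
  B `<=` B' <->
  forall a, box_neg B' (val a) `<=` box_pos B (upset_imp_set (val a) set0).
Proof.
move=> upB upB'; split=> [H a u Ba v Buv v' vv' av'|H [u v] Buv].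
  by apply: (Ba v' _ av'); apply: H; exact: box_pos_mono upB (lexx u) vv' Buv.
apply: contrapT => nB'.
(* The pseudo-complement of [principal v] omits [v], which contradicts [B (u, v)] once [u] is in the
   negative box. *)
apply: (H (principal v) u _ v Buv v (lexx v) (lexx v)) => w B'uw vw.
by apply: nB'; exact: box_neg_mono upB' (lexx u) vw B'uw.
Qed.

Lemma BackDiaBox_neg_pos D D' :
    modal_relation (Dia Neg) D -> modal_relation (Dia Pos) D' ->
  D `<=` D' <->
  forall a, dia_neg D (upset_imp_set (val a) set0) `<=` dia_pos D' (val a).
Proof.
move=> upD upD'; split=> [H a u [v nv Duv]|H [u v] Duv].
  apply: contrapT => nD'; apply: nv => v' vv' av'; apply: nD'; exists v' => //.
  by apply: H; exact: dia_neg_mono upD (lexx u) vv' Duv.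
have [|w vw D'uw] := H (principal v) u.
  by exists v => // /(_ v (lexx v) (lexx v)).
exact: dia_pos_mono upD' (lexx u) vw D'uw.
Qed.

Lemma BackBoxDia_pos_neg D D' :
    modal_relation (Dia Pos) D -> modal_relation (Dia Neg) D' ->
  D `<=` D' <->
  forall a, dia_pos D (upset_coimp_set setT (val a)) `<=` dia_neg D' (val a).
Proof.
move=> upD upD'; split=> [H a u [v [v' v'v [_ nav']] Duv]|H [u v] Duv].
  by exists v' => //; apply: H; exact: dia_pos_mono upD (lexx u) v'v Duv.
have [|w /contrapT wv D'uw] := H (avoiding v) u.
  (* The dual pseudo-complement of [avoiding v] contains [v], since [v] is not in [avoiding v]. *)
  by exists v => //; exists v => //; split=> //=; apply.
exact: dia_neg_mono upD' (lexx u) wv D'uw.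
Qed.

Lemma BackBoxDia_neg_pos B B' :
    modal_relation (Box Neg) B -> modal_relation (Box Pos) B' ->
  B `<=` B' <->
  forall a, box_pos B' (val a) `<=` box_neg B (upset_coimp_set setT (val a)).
Proof.
move=> upB upB'; split=> [H a u Ba v Buv [v' v'v [_ nav']]|H [u v] Buv].
  apply: nav'; apply: Ba; apply: H.
  exact: box_neg_mono upB (lexx u) v'v Buv.
apply: contrapT => nB'; apply: (H (avoiding v) u _ v Buv).
  move=> w B'uw wv; apply: nB'.
  exact: box_pos_mono upB' (lexx u) wv B'uw.
by exists v => //; split=> //=; apply.
Qed.

End Correspondence.

(** * Transfer from inclusions of sets to the order of the complex algebra *)

Theorem mainTheorem10 (L : signature) (d : Order.disp_t) (W : porderType d)
    (F : frame L W) (uF : unimodal F) (l : label)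
    (L1 : L (label_modalities l).1) (L2 : L (label_modalities l).2) :
  frame_condition F L1 L2 <-> equation (complex_algebra F) L1 L2.
Proof.
(* Bundled rewrite rules for meets, joins and bounds; implication and co-implication unfold by
   computation. *)
have E := (@upset_meetE d W, @upset_joinE d W, @upset0E d W, @upset1E d W).
have le_val (a b : complex_algebra F) : (a <= b)%O <-> val a `<=` val b.
  by split=> /le_upsetP.
move: L1 L2; case: l => -[] [] /= L1 L2;
  have u1 := frame_rel_upset F L1; have u2 := frame_rel_upset F L2.
- apply: (iff_trans (DiaBox_pos_pos u1 u2)).
  by split=> H a b; have := H a b; rewrite le_val /= ?E.
- apply: (iff_trans (DiaBox_pos_neg _ u2)).
  by split=> H a; have := H a; rewrite le_val /= ?E.
- apply: (iff_trans (DiaBox_neg_pos _ u2)).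
  by split=> H a; have := H a; rewrite le_val /= ?E.
- apply: (iff_trans (DiaBox_neg_neg u1 u2)).
  by split=> H a b; have := H a b; rewrite le_val /= ?E.
- apply: (iff_trans (BoxDia_pos_pos u1 u2)).
  by split=> H a b; have := H a b; rewrite le_val /= ?E.
- apply: (iff_trans (BoxDia_pos_neg _ u2)).
  by split=> H a; have := H a; rewrite le_val /= ?E.
- apply: (iff_trans (BoxDia_neg_pos _ u2)).
  by split=> H a; have := H a; rewrite le_val /= ?E.
- apply: (iff_trans (BoxDia_neg_neg u1 u2)).
  by split=> H a b; have := H a b; rewrite le_val /= ?E.
- apply: (iff_trans (BackDiaBox_pos_pos u1 u2)).
  by split=> H a b; have := H a b; rewrite le_val /= ?E.
- apply: (iff_trans (BackDiaBox_pos_neg u1 u2)).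
  by split=> H a; have := H a; rewrite le_val /= ?E.
- apply: (iff_trans (BackDiaBox_neg_pos u1 u2)).
  by split=> H a; have := H a; rewrite le_val /= ?E.
- apply: (iff_trans (BackDiaBox_neg_neg u1 u2)).
  by split=> H a b; have := H a b; rewrite le_val /= ?E.
- apply: (iff_trans (BackBoxDia_pos_pos u1 u2)).
  by split=> H a b; have := H a b; rewrite le_val /= ?E.
- apply: (iff_trans (BackBoxDia_pos_neg u1 u2)).
  by split=> H a; have := H a; rewrite le_val /= ?E.
- apply: (iff_trans (BackBoxDia_neg_pos u1 u2)).
  by split=> H a; have := H a; rewrite le_val /= ?E.
- apply: (iff_trans (BackBoxDia_neg_neg u1 u2)).
  by split=> H a b; have := H a b; rewrite le_val /= ?E.
Qed.
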